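(* Let $G_1$ and $G_2$ be finite groups such that $G_1$ admits a DRR (respectively, a GRR) and $G_2$ is not DRR-detecting (respectively, not GRR-detecting). Then $G_1 \times G_2$ is not DRR-detecting (respectively, not GRR-detecting).
   Context: All groups and graphs are finite. For a subset $S$ of a group $G$, the Cayley digraph $\mathrm{Cay}(G,S)$ has vertex set $G$ and a directed edge from $g_1$ to $g_2$ iff $g_2 = s g_1$ for some $s \in S$; if $S$ is inverse-closed it is a graph (Cayley graph). $\mathrm{Aut}(G,S) = \{\varphi \in \mathrm{Aut}(G) : \varphi(S) = S\}$. A digraph $\Gamma$ is a DRR of $G$ if $\mathrm{Aut}(\Gamma) \cong G$ and acts regularly on the vertices; a GRR is a DRR that is a graph. $G$ is GRR-detecting if for every inverse-closed $S \subseteq G$, $\mathrm{Aut}(G,S)=\{1\}$ implies $\mathrm{Cay}(G,S)$ is a GRR; $G$ is DRR-detecting if for every $S \subseteq G$, $\mathrm{Aut}(G,S)=\{1\}$ implies $\mathrm{Cay}(G,S)$ is a DRR. *)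

(* Defs.v *)
From mathcomp Require Import all_boot all_fingroup.

Set Implicit Arguments.
Unset Strict Implicit.
Unset Printing Implicit Defensive.

Local Open Scope group_scope.

(* A digraph on the finite vertex set V is its arc relation e : rel V.
   Loops are allowed, since a connection set S may contain 1. *)
Section Digraph.

Variables (V : finType) (e : rel V).

Definition digraph_aut : {set {perm V}} :=
  [set a : {perm V} | [forall x, forall y, e (a x) (a y) == e x y]].

Lemma digraph_autP (a : {perm V}) :
  reflect (forall x y, e (a x) (a y) = e x y) (a \in digraph_aut).
Proof.
rewrite inE; apply: (iffP forallP) => [aut_a x y | aut_a x].
  by apply/eqP; move: (aut_a x) => /forallP.
by apply/forallP=> y; rewrite aut_a.
Qed.

Lemma digraph_aut_group_set : group_set digraph_aut.
Proof.
apply/group_setP; split=> [|a b /digraph_autP aut_a /digraph_autP aut_b].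
  by apply/digraph_autP=> x y; rewrite !perm1.
by apply/digraph_autP=> x y; rewrite !permM aut_b aut_a.
Qed.

Canonical digraph_aut_group := Group digraph_aut_group_set.

End Digraph.

Definition regular_on (V : finType) (A : {set {perm V}}) : Prop :=
  [transitive A, on [set: V] | 'P] /\ forall x : V, 'C_A[x | 'P] = 1.

Section Representations.

Variable G : finGroupType.

Definition is_DRR (V : finType) (e : rel V) : Prop :=
  digraph_aut e \isog [set: G] /\ regular_on (digraph_aut e).

Definition is_GRR (V : finType) (e : rel V) : Prop :=
  is_DRR e /\ symmetric e.

Definition admits_DRR : Prop := exists (V : finType) (e : rel V), is_DRR e.

Definition admits_GRR : Prop := exists (V : finType) (e : rel V), is_GRR e.

Definition cayley (S : {set G}) : rel G :=
  fun g1 g2 => [exists s in S, g2 == s * g1].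

Definition inverse_closed (S : {set G}) : Prop :=
  forall s, s \in S -> s^-1 \in S.

Definition Aut_fixing (S : {set G}) : {set {perm G}} :=
  [set a in Aut [set: G] | a @: S == S].

Definition DRR_detecting : Prop :=
  forall S : {set G}, Aut_fixing S = 1 -> is_DRR (cayley S).

Definition GRR_detecting : Prop :=
  forall S : {set G}, inverse_closed S -> Aut_fixing S = 1 ->
    is_GRR (cayley S).

End Representations.

Arguments is_DRR G [V] e.
Arguments is_GRR G [V] e.

(* Main.v *)
(** Deleting 1 from a connection set and possibly complementing it in G \ {1}
    changes neither the digraph automorphisms nor the triviality of Aut(G, S),
    and makes S at least half of G \ {1}.  Such an S generates G, and if
    Aut(G, S) = 1 it is indecomposable: S \subset A \cup B with G = A x B forces
    A = 1 or B = 1, by counting, because a factor with A \ {1} \subset S has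
    trivial automorphism group, hence at most two elements.

    Let S1 give a DRR of G1, let S2 witness that G2 is not detecting, both
    normalized in this way, and let S be the connection set of the Cartesian
    product of the two Cayley digraphs.  By indecomposability, an automorphism
    of G1 x G2 preserving S maps each factor into a factor.  If it preserves
    both factors it is trivial; if it swaps them, the two Cayley digraphs are
    isomorphic, although only the first one is a DRR.  So Aut(G1 x G2, S) = 1,
    whereas a nontrivial automorphism of Cay(G2, S2) fixing 1 still acts on the
    product. *)
Require Import Defs.
From mathcomp Require Import all_boot all_fingroup all_solvable zify.

Set Implicit Arguments.
Unset Strict Implicit.
Unset Printing Implicit Defensive.

Local Open Scope group_scope.

(** * Nontrivial automorphisms of groups with more than two elements *)

Lemma involutive_automorphism (gT : finGroupType) (A : {group gT})
    (f : gT -> gT) :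
    {in A &, {morph f : x y / x * y}} -> {in A, forall x, f x \in A} ->
    {in A, involutive f} ->
  exists2 g : {morphism A >-> gT}, 'injm g /\ g @* A = A & g =1 f.
Proof.
move=> fM fA fK; exists (Morphism fM) => //.
have injf : 'injm (Morphism fM) by apply/injmP/(can_in_inj fK).
split=> //; apply/eqP; rewrite eqEcard card_injm // leqnn andbT.
by apply/subsetP=> _ /morphimP[x _ Ax ->]; apply: fA.
Qed.

(** An inner automorphism works if [A] is not abelian, and inversion if [A] is abelian of exponent
    above 2. Otherwise [A] is an elementary abelian 2-group of rank at least 2, which has a
    transvection. *)
Lemma nontrivial_automorphism (gT : finGroupType) (A : {group gT}) :
    2 < #|A| ->
  exists2 f : {morphism A >-> gT}, 'injm f /\ f @* A = A
    & exists2 x, x \in A & f x != x.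
Proof.
move=> A_gt2; have [cAA | ] := boolP (abelian A); last first.
  case/subsetPn=> x Ax ncx.
  have [y Ay nxy] : exists2 y, y \in A & y ^ x != y.
    apply/exists_inP; apply: contraR ncx; rewrite negb_exists_in.
    move/forall_inP=> fixA; apply/centP=> y Ay.
    by apply/esym/commgP/conjg_fixP/eqP; rewrite -[_ == _]negbK fixA.
  exists (conjgm_morphism A x); last by exists y.
  by split; [exact: injm_conj | rewrite /= norm_conjg_im // (subsetP (normG A))].
have [oddx | sqA] := boolP [exists x in A, x ^+ 2 != 1].
  have [x Ax x2] := exists_inP oddx.
  have [|y Ay|y _|f fA fE] := @involutive_automorphism _ A (fun x => x^-1).
  - by move=> y z Ay Az; rewrite invMg (centsP cAA) ?groupV.
  - by rewrite groupV.
  - exact: invgK.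
  exists f => //; exists x => //; rewrite fE.
  by apply: contra x2 => /eqP xV; rewrite expgS expg1 -{1}xV mulVg.
have abA: 2.-abelem A.
  apply/abelemP=> //; split=> // x Ax; apply/eqP.
  by apply: contraR sqA => x2; apply/exists_inP; exists x.
have pA := abelem_pgroup abA.
have [M maxM] : exists M : {group gT}, maximal M A.
  case: (maximal_exists (sub1G A)) => [A1 | [M maxM _]]; last by exists M.
  by move: A_gt2; rewrite -A1 cards1.
have iM := p_maximal_index pA maxM; have sMA := proper_sub (maxgroupp maxM).
have [z Mz nz] : exists2 z, z \in M & z != 1.
  apply/trivgPn; rewrite trivg_card1; apply: contraL A_gt2 => /eqP M1.
  by rewrite -(Lagrange sMA) M1 iM.
(* As [M] has index 2, membership in it behaves like a homomorphism to the group of order 2. *)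
have MM x y : x \in A -> y \in A -> (x * y \in M) = ((x \in M) == (y \in M)).
  move=> Ax Ay; have [Mx | nMx] := boolP (x \in M); first by rewrite groupMl.
  have [My | nMy] := boolP (y \in M); first by rewrite groupMr // (negPf nMx).
  have := rcoset_index2 sMA iM (x := x^-1); rewrite !inE groupV nMx groupV Ax.
  move=> /(_ isT) /setP/(_ y); rewrite mem_rcoset invgK inE nMy Ay => yx.
  by rewrite (centsP cAA x).
have [_ sq1] := abelemP (isT : prime 2) abA.
have Az := subsetP sMA z Mz.
have z2 : z * z = 1 := sq1 z Az.
(* A transvection: identity on the hyperplane M, translation by z \in M off it. *)
pose f x := if x \in M then x else z * x.
have fA : {in A, forall x, f x \in A}.
  by move=> x Ax; rewrite /f; case: ifP; rewrite ?groupM.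
have [|x Ax|g gA gE] := @involutive_automorphism _ A f _ fA.
- move=> x y Ax Ay; rewrite /f MM //.
  case: (x \in M); case: (y \in M) => //=; rewrite ?mulgA //.
    by rewrite (centsP cAA x Ax z Az).
  by rewrite -(mulgA z x z) (centsP cAA x Ax z Az) // mulgA z2 mul1g.
- rewrite /f; have [Mx | nMx] := boolP (x \in M); first by rewrite Mx.
  by rewrite groupMl // (negPf nMx) mulgA z2 mul1g.
have [x Ax nMx] : exists2 x, x \in A & x \notin M.
  by case/properP: (maxgroupp maxM).
exists g => //; exists x => //; rewrite gE /f (negPf nMx).
by apply: contra nz => /eqP/(canRL (mulgK x)) ->; rewrite mulgV.
Qed.

(** * Cayley digraphs and rigid connection sets *)

Lemma cayleyE (G : finGroupType) (S : {set G}) x y :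
  cayley S x y = (y * x^-1 \in S).
Proof.
apply/exists_inP/idP=> [[s Ss /eqP->] | Syx]; first by rewrite mulgK.
by exists (y * x^-1); rewrite ?mulgKV.
Qed.

(* Equivalent to Aut(G, S) = 1: since G is finite, the homomorphisms f below are
   the automorphisms of G with f(S) = S. *)
Definition rigid (G : finGroupType) (S : {set G}) :=
  forall f : G -> G, injective f -> {morph f : x y / x * y} ->
    {homo f : x / x \in S} -> f =1 id.

Lemma rigidP (G : finGroupType) (S : {set G}) :
  Aut_fixing S = 1 <-> rigid S.
Proof.
split=> [AutS1 f injf fM fS x | rigS].
  suff : perm injf \in Aut_fixing S.
    by rewrite AutS1 => /set1P/permP/(_ x); rewrite permE perm1.
  rewrite !inE; apply/andP; split.
    apply/andP; split; first by apply/subsetP=> u; rewrite inE.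
    by apply/morphicP=> u v _ _; rewrite !permE fM.
  rewrite eqEcard card_imset ?leqnn ?andbT; last exact: perm_inj.
  by apply/subsetP=> _ /imsetP[u Su ->]; rewrite permE fS.
apply/eqP; rewrite eqEsubset andbC sub1set inE group1 /=; apply/andP; split.
  by apply/eqP; rewrite -[RHS]imset_id; apply: eq_imset => u; rewrite perm1.
apply/subsetP=> a; rewrite inE => /andP[AutGa /eqP aS].
apply/set1P/permP=> x; rewrite perm1.
apply: rigS => [|u v|u Su]; first exact: perm_inj.
  by rewrite -(autmE AutGa) morphM ?inE.
by rewrite -aS imset_f.
Qed.

(** * Indecomposability of large rigid sets *)

Lemma injm_D1 (gT rT : finGroupType) (A : {group gT}) (B : {set rT})
    (f : {morphism A >-> rT}) x :
  'injm f -> f @* A = B -> x \in A -> x != 1 -> f x \in B^#.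
Proof.
by move=> injf <- Ax nx1; rewrite !inE morph_injm_eq1 // nx1 mem_morphim.
Qed.

(** A nontrivial automorphism of [A], extended by the identity on [B], would permute [A^#] and fix
    the rest of [S] pointwise, against rigidity. *)
Lemma complete_factor (G : finGroupType) (S : {set G}) (A B : {group G}) :
    rigid S -> 1 \notin S -> A \x B = [set: G] -> S \subset A :|: B ->
  A^# \subset S -> #|A| <= 2.
Proof.
move=> rigS nS1 defG sSAB sAS; rewrite leqNgt; apply/negP.
case/nontrivial_automorphism=> f [injf fA] [x Ax]; case/eqP.
have [_ _ cAB tiAB] := dprodP defG.
have cfAB : idm B @* B \subset 'C(f @* A) by rewrite fA morphim_idm.
rewrite -(dprodmEl defG cfAB Ax).
have injd : 'injm (dprodm defG cfAB).
  by rewrite injm_dprodm injf injm_idm fA morphim_idm ?tiAB ?eqxx.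
apply: rigS => [u v /(injmP injd)-> | u v | u Su]; rewrite ?morphM ?inE //.
case/setUP: (subsetP sSAB u Su) => [Au | Bu]; last by rewrite dprodmEr.
have nu1 : u != 1 by apply: contraNneq nS1 => <-.
by rewrite dprodmEl // (subsetP sAS) // injm_D1.
Qed.

(** Meant for [a], [b] the orders of the factors and [s], [sa], [sb] the sizes of [S] and of its
    traces on them. If both orders exceed 2, the bounds give [a * b <= 2 * (a + b - 4) + 1], that is
    (a - 2)(b - 2) <= -3. If only [a] is 2, they give [2 * b <= 2 * b - 1]. *)
Lemma card_factors (a b s sa sb : nat) :
    1 < a -> 1 < b -> a * b <= s.*2.+1 -> s <= sa + sb -> sa < a -> sb < b ->
    a <= 2 \/ sa.+2 <= a -> b <= 2 \/ sb.+2 <= b ->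
  [/\ a = 2, b = 2, a.-1 <= sa & b.-1 <= sb].
Proof.
case: a => [|[|a]] // _; case: b => [|[|b]] // _.
rewrite !mulnS !mulSn; have [a0 | a_gt0] := posnP a; have [b0 | b_gt0] := posnP b.
- by subst; split; lia.
- by subst; lia.
- by subst; lia.
- by nia.
Qed.

Section Indecomposable.

Variables (G : finGroupType) (S : {set G}).
Hypotheses (rigS : rigid S) (nS1 : 1 \notin S) (bigS : #|G| <= #|S|.*2.+1).

(** The subgroup [<<S>>] also contains 1, so it has more than [#|S|] elements; index at least 2
    would give [G] at least [2 * #|S| + 2] elements. *)
Lemma gen_big : <<S>> = [set: G].
Proof.
apply/eqP; rewrite eqEcard subsetT /= cardsT.
have ltS : #|S| < #|<<S>>|.
  by apply/proper_card/properP; split; [exact: subset_gen | exists 1].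
have := Lagrange (subsetT <<S>>); rewrite cardsT => cardG.
have := indexg_gt0 [set: G] <<S>>; move: cardG bigS.
case: #|_ : _|%g => [|[|k]] //= <-; rewrite ?muln1 // mulnS mulnS.
move: ltS; set m := #|S|; set n := #|_|; set p := (n * k)%N; lia.
Qed.

Variables A B : {group G}.
Hypotheses (cAB : B \subset 'C(A)) (tiAB : A :&: B = 1).
Hypothesis (sSAB : S \subset A :|: B).

Let defG : A \x B = [set: G].
Proof.
rewrite dprodEY //; apply/eqP; rewrite -subTset -gen_big gen_subG.
by rewrite (subset_trans sSAB) ?sub_gen.
Qed.

Let cardSI : #|S| <= #|S :&: A| + #|S :&: B|.
Proof. by rewrite -{1}(setIidPl sSAB) setIUr cardsU leq_subr. Qed.

Let cardI_lt (C : {group G}) : #|S :&: C| < #|C|.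
Proof.
apply/proper_card/properP; split; first exact: subsetIr.
by exists 1; rewrite ?group1 // inE (negPf nS1).
Qed.

Let cardI_max (C : {group G}) : #|C|.-1 <= #|S :&: C| -> C^# \subset S.
Proof.
have sub : S :&: C \subset C^#.
  rewrite subsetD1 subsetIr inE (negPf nS1) //.
have /eqP := cardsD1 1 C; rewrite group1 add1n => /eqP -> /= le_C.
have /eqP <- : S :&: C == C^# by rewrite eqEcard sub.
exact: subsetIl.
Qed.

Lemma indecomposable : S \subset A \/ S \subset B.
Proof.
have cardG := dprod_card defG; rewrite cardsT in cardG.
have [A1 | ntA] := eqVneq A 1%G.
  right; apply/subsetP=> x Sx; case/setUP: (subsetP sSAB x Sx) => //.
  by rewrite A1 => /set1P x1; rewrite x1 (negPf nS1) in Sx.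
have [B1 | ntB] := eqVneq B 1%G.
  left; apply/subsetP=> x Sx; case/setUP: (subsetP sSAB x Sx) => //.
  by rewrite B1 => /set1P x1; rewrite x1 (negPf nS1) in Sx.
have A_gt1 : 1 < #|A| by rewrite cardG_gt1.
have B_gt1 : 1 < #|B| by rewrite cardG_gt1.
(* Either [S] contains all of [A^#], or it misses 1 and at least one more element of [A]; hence the
   gap of 2. *)
have smallA : #|A| <= 2 \/ #|S :&: A|.+2 <= #|A|.
  case: (leqP #|A|.-1 #|S :&: A|) => [/cardI_max | ]; last by right; lia.
  by left; apply: (complete_factor rigS nS1 defG).
have smallB : #|B| <= 2 \/ #|S :&: B|.+2 <= #|B|.
  case: (leqP #|B|.-1 #|S :&: B|) => [/cardI_max | ]; last by right; lia.
  have defG' : B \x A = [set: G] by rewrite dprodC.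
  by left; apply: (complete_factor rigS nS1 defG'); rewrite // setUC.
have [A2 B2 /cardI_max sAS /cardI_max sBS] : [/\ #|A| = 2, #|B| = 2,
    #|A|.-1 <= #|S :&: A| & #|B|.-1 <= #|S :&: B|].
  by apply: (card_factors A_gt1 B_gt1 _ cardSI); rewrite ?cardG.
have cycA : cyclic A by rewrite prime_cyclic ?A2.
have cycB : cyclic B by rewrite prime_cyclic ?B2.
(* Both factors have order 2 and S consists of their two involutions, so that
   exchanging the factors preserves S. *)
have isoAB : A \isog B by rewrite isog_cyclic_card // cycB A2 B2.
have [f injf fA] := isogP isoAB.
have [g injg gB] := isogP (isog_symr isoAB).
have cfg : g @* B \subset 'C(f @* A) by rewrite fA gB centsC.
have injd : 'injm (dprodm defG cfg).
  by rewrite injm_dprodm injf injg fA gB setIC tiAB eqxx.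
have [x Ax nx1] := trivgPn _ ntA.
have /setD1P[_ Bfx] : f x \in B^# by rewrite injm_D1.
(* Rigidity makes the exchange of the factors the identity, which would put [x] in both [A] and
   [B]. *)
suff fx : f x = x.
  have : x \in A :&: B by rewrite inE Ax -fx.
  by rewrite tiAB inE (negPf nx1).
rewrite -(dprodmEl defG cfg Ax).
apply: rigS => [u v /(injmP injd)-> | u v | u Su]; rewrite ?morphM ?inE //.
have nu1 : u != 1 by apply: contraNneq nS1 => <-.
case/setUP: (subsetP sSAB u Su) => [Au | Bu].
  by rewrite dprodmEl // (subsetP sBS) // injm_D1.
by rewrite dprodmEr // (subsetP sAS) // injm_D1.
Qed.

End Indecomposable.

(** * DRRs as Cayley digraphs with trivial vertex stabilizer *)

(** Boolean, so that being a DRR can later be proved by contradiction constructively. *)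
Definition fixed_point_rigid (V : finType) (e : rel V) (v : V) :=
  [forall a in digraph_aut e, (a v == v) ==> (a == 1)].

Lemma fixed_point_rigidP (V : finType) (e : rel V) v :
  reflect (forall a : {perm V}, a \in digraph_aut e -> a v = v -> a = 1)
          (fixed_point_rigid e v).
Proof.
apply: (iffP forall_inP) => [rig a aut_a av | rig a aut_a].
  by apply/eqP/(implyP (rig a aut_a))/eqP.
by apply/implyP=> /eqP/(rig a aut_a)/eqP.
Qed.

Lemma fixed_point_rigid_bij (V W : finType) (e : rel V) (d : rel W) h v :
    bijective h -> (forall x y, d (h x) (h y) = e x y) ->
  fixed_point_rigid d (h v) -> fixed_point_rigid e v.
Proof.
move=> [k hK kH] hom_h /fixed_point_rigidP rig_d.
apply/fixed_point_rigidP=> a /digraph_autP aut_a av.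
have inj_b : injective (h \o a \o k).
  by move=> x y /(can_inj hK)/perm_inj/(can_inj kH).
have b1 : perm inj_b = 1.
  apply: rig_d; last by rewrite permE /= hK av.
  by apply/digraph_autP=> x y; rewrite !permE /= hom_h aut_a -hom_h !kH.
apply/permP=> x; rewrite perm1; apply: (can_inj hK).
by have /permP/(_ (h x)) := b1; rewrite permE perm1 /= hK.
Qed.

(** Right translations are always automorphisms of a Cayley digraph. If only the identity fixes 1,
    every automorphism [a] is the right translation by [a 1]. *)
Lemma is_DRR_cayleyP (G : finGroupType) (S : {set G}) :
  is_DRR G (cayley S) <-> fixed_point_rigid (cayley S) 1.
Proof.
split=> [[_ [_ /(_ 1) stab1]] | /fixed_point_rigidP rig].
  apply/fixed_point_rigidP=> a aut_a a1.
  suff : a \in 'C_(digraph_aut (cayley S))[1 | 'P] by rewrite stab1 => /set1P.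
  by rewrite inE aut_a; apply/astab1P.
have autR x : actperm 'R x \in digraph_aut (cayley S).
  apply/digraph_autP=> y z; rewrite !actpermE !cayleyE /= invMg mulgA.
  by rewrite -(mulgA z) mulgV mulg1.
have autE a : a \in digraph_aut (cayley S) -> a = actperm 'R (a 1).
  move=> aut_a; apply/eqP; rewrite eq_mulgV1; apply/eqP/rig.
    by rewrite groupM ?groupV.
  rewrite permM; apply: (canLR (permK _)).
  by rewrite actpermE /= mul1g.
split.
  rewrite isog_sym; apply/isogP; exists (actperm_morphism 'R).
    apply/injmP=> x y _ _ /permP/(_ 1).
    by rewrite !actpermE /= !mul1g.
  apply/eqP; rewrite eqEsubset; apply/andP; split.
    by apply/subsetP=> _ /morphimP[x _ _ ->]; apply: autR.
  by apply/subsetP=> a /autE->; rewrite mem_morphim ?inE.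
split=> [|x].
  apply/imsetP; exists 1; rewrite ?inE //; apply/esym/setP=> y; rewrite inE.
  apply/orbitP; exists (actperm 'R y) => //.
  by rewrite /= /aperm actpermE /= mul1g.
apply/trivgP/subsetP=> a /setIP[aut_a /astab1P ax].
have := autE _ aut_a; move: ax; rewrite /= /aperm => ax aE.
have a1 : a 1 = 1.
  by move: ax; rewrite {1}aE actpermE /= => /(canRL (mulKg x)); rewrite mulVg.
by apply/set1P/rig.
Qed.

(** Sabidussi's argument: choosing a base vertex [v] identifies the vertices with the elements of
    the regularly acting group. *)
Lemma is_DRR_connection_set (G : finGroupType) (V : finType) (e : rel V) :
    is_DRR G e ->
  exists2 S : {set G}, fixed_point_rigid (cayley S) 1
    & symmetric e -> inverse_closed S.
Proof.
move=> [isoG [transV stabV]].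
have [f injf fG] := isogP (isog_symr isoG).
have [v _ orbv] := imsetP transV.
have autf x : f x \in digraph_aut e by rewrite -fG mem_morphim ?inE.
pose h x := f x v.
have hM x y : h (x * y) = f y (h x) by rewrite /h morphM ?inE // permM.
have inj_h : injective h.
  move=> x y hxy; apply: (injmP injf); rewrite ?inE //.
  suff : f x * (f y)^-1 \in 'C_(digraph_aut e)[v | 'P].
    by rewrite stabV => /set1P/eqP; rewrite -eq_mulgV1 => /eqP.
  rewrite inE groupM ?groupV //=; apply/astab1P.
  by rewrite /= /aperm permM -/(h x) hxy permK.
have bij_h : bijective h.
  apply: inj_card_bij => //; rewrite -cardsT orbv.
  apply: leq_trans (leq_imset_card _ _) _.
  by rewrite -fG card_injm // cardsT.
(* The out-neighbours of [v = h 1], read in [G]. *)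
pose S := [set x | e v (h x)].
have eS x y : e (h x) (h y) = cayley S x y.
  rewrite cayleyE inE; have /digraph_autP autx := autf x.
  by rewrite -[RHS]autx -hM mulgKV.
exists S.
  apply: (fixed_point_rigid_bij bij_h eS); apply/fixed_point_rigidP=> a aut_a.
  rewrite /h morph1 perm1 => av.
  suff : a \in 'C_(digraph_aut e)[v | 'P] by rewrite stabV => /set1P.
  by rewrite inE aut_a; apply/astab1P.
move=> sym_e s.
have -> : s \in S = cayley S 1 s by rewrite cayleyE invg1 mulg1.
by rewrite -eS sym_e eS cayleyE mul1g.
Qed.

Lemma cayley_sym (G : finGroupType) (S : {set G}) :
  inverse_closed S -> symmetric (cayley S).
Proof.
move=> invS x y; rewrite !cayleyE.
by apply/idP/idP=> /invS; rewrite invMg invgK.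
Qed.

Lemma homo_inj_mem (T : finType) (S : {set T}) (f : T -> T) :
    injective f -> {homo f : x / x \in S} -> forall x, (f x \in S) = (x \in S).
Proof.
move=> injf fS x; have fSS : f @: S = S.
  apply/eqP; rewrite eqEcard card_imset // leqnn andbT.
  by apply/subsetP=> _ /imsetP[y Sy ->]; apply: fS.
by rewrite -{1}fSS mem_imset.
Qed.

(** A group automorphism preserving [S] is a digraph automorphism fixing 1. *)
Lemma fixed_point_rigid_rigid (G : finGroupType) (S : {set G}) :
  fixed_point_rigid (cayley S) 1 -> rigid S.
Proof.
move=> /fixed_point_rigidP rig f injf fM fS x.
have f1 : f 1 = 1 by apply: (mulgI (f 1)); rewrite -fM !mulg1.
have fV y : f y^-1 = (f y)^-1.
  by apply: (mulgI (f y)); rewrite -fM !mulgV.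
have a1 : perm injf = 1.
  apply: rig; last by rewrite permE.
  apply/digraph_autP=> y z; rewrite !permE !cayleyE -fV -fM.
  exact: homo_inj_mem.
by have /permP/(_ x) := a1; rewrite permE perm1.
Qed.

(** * Normalization of connection sets *)

Lemma rigid_normalize (G : finGroupType) (T : {set G}) :
  exists S : {set G}, [/\ 1 \notin S, #|G| <= #|S|.*2.+1,
    digraph_aut (cayley S) = digraph_aut (cayley T),
    rigid T -> rigid S & inverse_closed T -> inverse_closed S].
Proof.
(* The bit [b] tells whether to complement. The two candidates partition the nonidentity elements,
   so the larger has at least half of them. *)
pose C b := [set x | (x != 1) && ((x \in T) (+) b)].
have [b bigC] : exists b, #|G| <= #|C b|.*2.+1.
  have cardG : #|G| <= (#|C true| + #|C false|).+1.
    rewrite -cardsT (cardsD1 1 [set: G]) in_setT add1n ltnS.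
    apply: leq_trans (leq_card_setU _ _); apply/subset_leq_card/subsetP=> x.
    by rewrite !inE; case: (x == 1); case: (x \in T).
  by case: (leqP #|C true| #|C false|) => ?; [exists false | exists true]; lia.
have CT x : x != 1 -> (x \in C b) = (x \in T) (+) b by rewrite inE => ->.
exists (C b); split=> //; first by rewrite inE eqxx.
- have cayC x y : cayley (C b) x y = (y != x) && (cayley T x y (+) b).
    by rewrite !cayleyE inE -eq_mulgV1.
  apply/setP=> a; apply/digraph_autP/digraph_autP=> aut_a x y; last first.
    by rewrite !cayC aut_a (inj_eq perm_inj).
  (* Loops, which [C b] forgets, occur at every vertex or at none. *)
  have [-> | nyx] := eqVneq x y; first by rewrite !cayleyE !mulgV.
  have := aut_a x y; rewrite !cayC (inj_eq perm_inj) eq_sym nyx /=.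
  exact: addIb.
- move=> rigT f injf fM fC; apply: rigT => // x Tx.
  have f1 : f 1 = 1 by apply: (mulgI (f 1)); rewrite -fM !mulg1.
  have [x1 | nx1] := eqVneq x 1; first by rewrite x1 f1 -x1.
  have nfx1 : f x != 1 by rewrite -f1 (inj_eq injf).
  have := homo_inj_mem injf fC x; rewrite !CT // Tx => /addIb; exact.
- move=> invT x; rewrite !inE invg_eq1 => /andP[-> /=].
  suff -> : (x^-1 \in T) = (x \in T) by [].
  by apply/idP/idP=> /invT //; rewrite invgK.
Qed.

(** * Cartesian products of Cayley digraphs *)

(** The kernels [A] and [B] of the two components of [h] commute and meet trivially since [h] is
    injective, and they cover [T]. Indecomposability puts [T], hence the group it generates, inside
    one of them. *)
Lemma factor_image (H G1 G2 : finGroupType) (T : {set H}) (h : H -> G1 * G2) :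
    rigid T -> 1 \notin T -> #|H| <= #|T|.*2.+1 ->
    injective h -> {morph h : x y / x * y} ->
    (forall t, t \in T -> (h t).1 = 1 \/ (h t).2 = 1) ->
  (forall x, (h x).1 = 1) \/ (forall x, (h x).2 = 1).
Proof.
move=> rigT nT1 bigT injh hM hT.
pose f := Morphism (in2W hM : {in [set: H] &, _}).
pose A := (f @*^-1 setX 1 [set: G2])%G; pose B := (f @*^-1 setX [set: G1] 1)%G.
have memA x : (x \in A) = ((h x).1 == 1) by rewrite !inE andbT.
have memB x : (x \in B) = ((h x).2 == 1) by rewrite !inE.
have cAB : B \subset 'C(A).
  apply/centsP=> x; rewrite memB => /eqP hx2 y; rewrite memA => /eqP hy1.
  apply: injh; rewrite !hM; move: (h x) (h y) hx2 hy1.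
  by move=> [x1 x2] [y1 y2] /= -> ->; congr (_, _); rewrite /= ?mulg1 ?mul1g.
have tiAB : A :&: B = 1.
  apply/trivgP/subsetP=> x; rewrite inE memA memB => /andP[/eqP hx1 /eqP hx2].
  apply/set1P/injh; have h1 : h 1 = 1 by apply: (mulgI (h 1)); rewrite -hM !mulg1.
  by rewrite h1; case: (h x) hx1 hx2 => x1 x2 /= -> ->.
have sTAB : T \subset A :|: B.
  apply/subsetP=> t /hT hTt; rewrite inE memA memB.
  by case: hTt => ->; rewrite eqxx ?orbT.
have full (C : {group H}) : T \subset C -> forall x, x \in C.
  by move=> sTC x; rewrite (subsetP (_ : <<T>> \subset C)) ?gen_subG ?gen_big ?inE.
case: (indecomposable rigT nT1 bigT cAB tiAB sTAB) => /full sT; [left | right].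
  by move=> x; apply/eqP; rewrite -memA.
by move=> x; apply/eqP; rewrite -memB.
Qed.

Section Product.

Variables (G1 G2 : finGroupType) (S1 : {set G1}) (S2 : {set G2}).

Definition box_set : {set G1 * G2} := setX S1 1 :|: setX 1 S2.

Lemma box_setE x y :
  ((x, y) \in box_set) = (x \in S1) && (y == 1) || (x == 1) && (y \in S2).
Proof. by rewrite !inE. Qed.

Lemma box_set_inverse_closed :
  inverse_closed S1 -> inverse_closed S2 -> inverse_closed box_set.
Proof.
move=> inv1 inv2 [x y]; rewrite (_ : (x, y)^-1 = (x^-1, y^-1)) // !box_setE.
by rewrite !invg_eq1 => /orP[/andP[/inv1-> ->] | /andP[-> /inv2->]]; rewrite ?orbT.
Qed.

(** Acting by [a] on the second coordinate alone respects both kinds of arcs of the product. *)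
Lemma box_fixed_point_rigid :
  fixed_point_rigid (cayley box_set) 1 -> fixed_point_rigid (cayley S2) 1.
Proof.
move=> /fixed_point_rigidP rig; apply/fixed_point_rigidP=> a /digraph_autP aut_a a1.
have cayE x y x' y' : cayley box_set (x, y) (x', y') =
    (x' * x^-1 \in S1) && (y' == y) || (x' == x) && cayley S2 y y'.
  rewrite !cayleyE (_ : _ * _ = (x' * x^-1, y' * y^-1)) // box_setE.
  by rewrite -!eq_mulgV1.
have inj_b : injective (fun p : G1 * G2 => (p.1, a p.2)).
  by move=> [x y] [x' y'] [-> /perm_inj->].
have b1 : perm inj_b = 1.
  apply: rig; last by rewrite permE /= a1.
  apply/digraph_autP=> [[x y] [x' y']].
  by rewrite !permE /= !cayE aut_a (inj_eq perm_inj).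
apply/permP=> y; rewrite perm1.
by have /permP/(_ (1, y)) := b1; rewrite permE perm1 => -[].
Qed.

Hypotheses (rig1 : rigid S1) (nS1 : 1 \notin S1) (big1 : #|G1| <= #|S1|.*2.+1).
Hypotheses (rig2 : rigid S2) (nS2 : 1 \notin S2) (big2 : #|G2| <= #|S2|.*2.+1).
Hypothesis not_iso : forall h : G2 -> G1, bijective h ->
  {morph h : x y / x * y} -> ~ (forall y, (h y \in S1) = (y \in S2)).

Lemma box_rigid : rigid box_set.
Proof.
move=> f injf fM fS.
have f1 : f 1 = 1 by apply: (mulgI (f 1)); rewrite -fM !mulg1.
pose i x : G1 * G2 := f (x, 1); pose j y : G1 * G2 := f (1, y).
have fE x y : f (x, y) = i x * j y.
  by rewrite /i /j -fM; congr (f (_, _)); rewrite /= ?mulg1 ?mul1g.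
have inji : injective i by move=> x x' /injf[].
have injj : injective j by move=> y y' /injf[].
have iM : {morph i : x y / x * y}.
  by move=> x y; rewrite /i -fM; congr (f (_, _)); rewrite /= mulg1.
have jM : {morph j : x y / x * y}.
  by move=> x y; rewrite /j -fM; congr (f (_, _)); rewrite /= mulg1.
have iS x : x \in S1 -> i x \in box_set.
  by move=> S1x; apply: fS; rewrite box_setE S1x eqxx.
have jS y : y \in S2 -> j y \in box_set.
  by move=> S2y; apply: fS; rewrite box_setE S2y eqxx orbT.
have axes p : p \in box_set -> p.1 = 1 \/ p.2 = 1.
  by case: p => x y; rewrite box_setE => /orP[] /andP[/= ? ?]; [right|left]; apply/eqP.
have case_i := factor_image rig1 nS1 big1 inji iM (fun x Sx => axes _ (iS x Sx)).
have case_j := factor_image rig2 nS2 big2 injj jM (fun x Sx => axes _ (jS x Sx)).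
have [g gK Kg] := injF_bij injf.
have straight : (forall x, (i x).2 = 1) -> (forall y, (j y).1 = 1) -> f =1 id.
  move=> i2 j1 [x y].
  have ix : (i x).1 = x.
    apply: (rig1 (f := fun x => (i x).1)) => [u v uv | u v | u Su].
    - by apply: inji; apply: injective_projections; rewrite ?i2.
    - by rewrite iM.
    (* Since 1 is not in [S2], an element of [box_set] on the first axis comes from [S1]. *)
    - have := iS u Su; rewrite [i u]surjective_pairing i2 box_setE eqxx andbT.
      by rewrite (negPf nS2) andbF orbF.
  have jy : (j y).2 = y.
    apply: (rig2 (f := fun y => (j y).2)) => [u v uv | u v | u Su].
    - by apply: injj; apply: injective_projections; rewrite ?j1.
    - by rewrite jM.
    - have := jS u Su; rewrite [j u]surjective_pairing j1 box_setE eqxx.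
      by rewrite (negPf nS1).
  rewrite fE [i x]surjective_pairing [j y]surjective_pairing i2 j1 ix jy.
  by congr (_, _); rewrite /= ?mulg1 ?mul1g.
case: case_i case_j => [i1 | i2] [j1 | j2].
(* Both axes land in the second one. As [f] is onto, [G1] is trivial, and [f] still counts as
   straight. *)
- apply: straight => // x; suff -> : x = 1 by rewrite /i f1.
  by have := Kg (x, 1); case: (g _) => u v; rewrite fE => -[<- _]; rewrite i1 j1 mulg1.
(* The axes are exchanged. Injections both ways between the groups, and between [S1] and [S2], make
   [h] an isomorphism carrying [S2] onto [S1]. *)
- exfalso; pose h y := (j y).1.
  have injh : injective h.
    by move=> u v uv; apply: injj; apply: injective_projections; rewrite ?j2.
  have injk : injective (fun x => (i x).2).
    by move=> u v uv; apply: inji; apply: injective_projections; rewrite ?i1.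
  have hS y : y \in S2 -> h y \in S1.
    move=> /jS; rewrite [j y]surjective_pairing j2 box_setE eqxx andbT.
    by rewrite (negPf nS2) andbF orbF.
  have kS x : x \in S1 -> (i x).2 \in S2.
    by move=> /iS; rewrite [i x]surjective_pairing i1 box_setE eqxx (negPf nS1).
  have hSS : h @: S2 = S1.
    apply/eqP; rewrite eqEcard card_imset //; apply/andP; split.
      by apply/subsetP=> _ /imsetP[y /hS ? ->].
    rewrite -(card_imset _ injk); apply/subset_leq_card/subsetP.
    by move=> _ /imsetP[x /kS ? ->].
  apply: (not_iso (h := h)) => [|u v|y].
  + by apply: inj_card_bij => //; apply: leq_card injk.
  + by rewrite /h jM.
  + by rewrite -hSS mem_imset.
- exact: straight.
- apply: straight => // y; suff -> : y = 1 by rewrite /j f1.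
  by have := Kg (1, y); case: (g _) => u v; rewrite fE => -[_ <-]; rewrite i2 j2 mulg1.
Qed.

End Product.

(** * Failure of detection in direct products *)

Lemma rigid_product (G1 G2 : finGroupType) (T1 : {set G1}) (T2 : {set G2}) :
    fixed_point_rigid (cayley T1) 1 -> rigid T2 ->
    ~~ fixed_point_rigid (cayley T2) 1 ->
  exists S : {set G1 * G2}, [/\ rigid S, ~~ fixed_point_rigid (cayley S) 1
    & inverse_closed T1 -> inverse_closed T2 -> inverse_closed S].
Proof.
move=> fprT1 rigT2 nfprT2.
have [S1 [nS1 big1 aut1 rig1 inv1]] := rigid_normalize T1.
have [S2 [nS2 big2 aut2 rig2 inv2]] := rigid_normalize T2.
have nfprS2 : ~~ fixed_point_rigid (cayley S2) 1.
  by rewrite /fixed_point_rigid aut2.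
exists (box_set S1 S2); split.
- apply: box_rigid => //; [| exact: rig2 |].
    exact/rig1/fixed_point_rigid_rigid.
  (* Such an [h] would transfer the trivial stabilizer from the first Cayley digraph to the
     second. *)
  move=> h bij_h hM hS; case/negP: nfprS2.
  have h1 : h 1 = 1 by apply: (mulgI (h 1)); rewrite -hM !mulg1.
  have hV y : h y^-1 = (h y)^-1 by apply: (mulgI (h y)); rewrite -hM !mulgV.
  apply: (fixed_point_rigid_bij (d := cayley S1) bij_h) => [x y|].
    by rewrite !cayleyE -hV -hM hS.
  by rewrite h1 /fixed_point_rigid aut1.
- by apply: contra nfprS2 => /box_fixed_point_rigid.
- by move=> /inv1 ? /inv2 ?; apply: box_set_inverse_closed.
Qed.

Theorem theorem1p9 (G1 G2 : finGroupType) :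
  (admits_DRR G1 -> ~ DRR_detecting G2 -> ~ DRR_detecting (G1 * G2)%type) /\
  (admits_GRR G1 -> ~ GRR_detecting G2 -> ~ GRR_detecting (G1 * G2)%type).
Proof.
split=> [[V [e drr_e]] ndet2 det | [V [e [drr_e sym_e]]] ndet2 det].
  have [T1 fprT1 _] := is_DRR_connection_set drr_e.
  (* If the product were detecting, so would be [G2]: a rigid [T2] not giving a DRR yields such a
     set in the product. *)
  apply: ndet2 => T2 /rigidP rigT2; apply/is_DRR_cayleyP/negPn/negP=> nfprT2.
  have [S [rigS /negP nfprS _]] := rigid_product fprT1 rigT2 nfprT2.
  by apply/nfprS/is_DRR_cayleyP/det/rigidP.
have [T1 fprT1 /(_ sym_e) invT1] := is_DRR_connection_set drr_e.
apply: ndet2 => T2 invT2 /rigidP rigT2; split; last exact: cayley_sym.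
apply/is_DRR_cayleyP/negPn/negP=> nfprT2.
have [S [rigS /negP nfprS invS]] := rigid_product fprT1 rigT2 nfprT2.
apply/nfprS/is_DRR_cayleyP.
by case: (det S (invS invT1 invT2)) => //; apply/rigidP.
Qed.
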